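(* Let $d\ge 1$ and let $W:\mathbb{R}^d\to\mathbb{R}\cup\{+\infty\}$ be lower semicontinuous, bounded from below by a finite constant, locally integrable and symmetric ($W(-x)=W(x)$ for all $x$). Suppose that the limit $W_\infty:=\lim_{|x|\to\infty}W(x)$ exists in $\mathbb{R}\cup\{+\infty\}$ and that there is $R_W>0$ such that $W$ is radially strictly increasing on $\mathbb{R}^d\setminus B_{R_W}$. (1) If $W$ is bounded from above and upper semicontinuous, then $(E_N)_{N\ge2}$ $\Gamma$-converges (narrowly) to $E$ on $\mathcal{P}(\mathbb{R}^d)$. (2) If $W$ is $\beta$-repulsive for some $2<\beta<d$, $W\in C^1(\mathbb{R}^d\setminus\{0\})$, and there is $C_W>0$ such that $\Delta^0W(x)\le C_W$ for all $x\in\mathbb{R}^d$, $W(x)\le C_W|x|^{2-\beta}$ for all $|x|\le 1$, and $|\nabla W(x)|\le C_W|x|^{1-\beta}$ for all $0<|x|\le 1$, then $(E_N)_{N\ge2}$ $\Gamma$-converges (narrowly) to $E$ on $\mathcal{M}_p(\mathbb{R}^d)\cap\mathcal{P}(\mathbb{R}^d)$ with $p=d/(d-\beta)$.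
   Context: $B_R(z)$ is the open ball of radius $R$ and centre $z$, $B_R:=B_R(0)$. $\mathcal{P}(\mathbb{R}^d)$ is the set of Borel probability measures on $\mathbb{R}^d$ with the narrow topology (duality with bounded continuous functions). ''Radially strictly increasing on $\mathbb{R}^d\setminus B_{R_W}$'' means $W(x)<W(y)$ whenever $R_W\le|x|<|y|$. For $N\ge2$ and $\boldsymbol{X}=(x_1,\dots,x_N)\in\mathbb{R}^{Nd}$, $E_N(\boldsymbol{X})=\frac{1}{2N^2}\sum_{i=1}^N\sum_{j\ne i}W(x_i-x_j)$ and $\mu_{\boldsymbol{X}}=\frac1N\sum_{i=1}^N\delta_{x_i}$. For $\rho\in\mathcal{P}(\mathbb{R}^d)$, $E(\rho)=\frac12\int\int W(x-y)\,d\rho(x)\,d\rho(y)$. $\Gamma$-convergence: for $A\subset\mathcal{P}(\mathbb{R}^d)$, $(E_N)_{N\ge2}$ $\Gamma$-converges (narrowly) to $E$ on $A$ if for all $\rho\in A$: (i) every sequence $(\boldsymbol{X}_N)_{N\ge2}$ with $\boldsymbol{X}_N\in\mathbb{R}^{Nd}$ and $\mu_{\boldsymbol{X}_N}\to\rho$ narrowly satisfies $E(\rho)\le\liminf_{N\to\infty}E_N(\boldsymbol{X}_N)$; (ii) there is a sequence $(\boldsymbol{X}_N^* )_{N\ge2}$ with $\boldsymbol{X}_N^*\in\mathbb{R}^{Nd}$, $\mu_{\boldsymbol{X}_N^*}\to\rho$ narrowly and $E(\rho)\ge\limsup_{N\to\infty}E_N(\boldsymbol{X}_N^* )$. Morrey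 spaces: for $p\in[1,\infty]$ with Hölder dual $q$, a finite signed Borel measure $\rho$ is in $\mathcal{M}_p(\mathbb{R}^d)$ if there is $M>0$ with $|\rho|(B_r(x))\le Mr^{d/q}$ for all $r>0$, $x\in\mathbb{R}^d$. Generalised Laplacian: $\Delta^\varepsilon W(x)=\frac{2(d+2)}{\varepsilon^2}\left(\frac{1}{|B_\varepsilon|}\int_{B_\varepsilon}W(x+y)\,dy-W(x)\right)$ for $\varepsilon>0$ (equal to $-\infty$ if $W(x)=+\infty$), and $\Delta^0W(x)=\liminf_{\varepsilon\to0}\Delta^\varepsilon W(x)\in[-\infty,+\infty]$. $W$ is $\beta$-repulsive if it is locally integrable and there exist $\delta>0$, $C>0$ with $-\Delta^0W(x)\ge C|x|^{-\beta}$ for all $0<|x|<\delta$ and $-\Delta^0W(0)=+\infty$. In (2), $|0|^{2-\beta}=+\infty$. *)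

(* Defs.v *)
From HB Require Import structures.
From mathcomp Require Import all_boot all_order all_algebra.
From mathcomp Require Import all_classical all_reals all_analysis.

Set Implicit Arguments.
Unset Strict Implicit.
Unset Printing Implicit Defensive.
Import Order.TTheory GRing.Theory Num.Theory.
Import numFieldNormedType.Exports.
Local Open Scope classical_set_scope.
Local Open Scope ring_scope.

(* The library provides neither a sigma-algebra on matrices nor Lebesgue
   measure on R^d; both are built here, R^d being 'rV[R]_d. *)

Section borel.
Context {R : realType} {m n : nat}.

Definition borel_mx : set (set 'M[R]_(m, n)) := <<s open >>.

Let borel_mx0 : borel_mx set0. Proof. exact: sigma_algebra0. Qed.

Let borel_mxC A : borel_mx A -> borel_mx (~` A).
Proof. exact: sigma_algebraC. Qed.

Let borel_mx_bigcup (F : (set 'M[R]_(m, n))^nat) :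
  (forall i, borel_mx (F i)) -> borel_mx (\bigcup_i F i).
Proof. exact: sigma_algebra_bigcup. Qed.

HB.instance Definition _ :=
  @isMeasurable.Build (sigma_display (@open 'M[R]_(m, n))) 'M[R]_(m, n)
    borel_mx borel_mx0 borel_mxC borel_mx_bigcup.

End borel.

(* The library's sigma-finite instance on \x is not found by inference. *)
Lemma sigma_finite_product d1 d2 (T1 : measurableType d1)
    (T2 : measurableType d2) (R : realType)
    (m1 : {sigma_finite_measure set T1 -> \bar R})
    (m2 : {sigma_finite_measure set T2 -> \bar R}) :
  sigma_finite setT (m1 \x m2)%E.
Proof.
have /sigma_finiteP[F [TF ndF Foo]] := sigma_finiteT m1.
have /sigma_finiteP[G [TG ndG Goo]] := sigma_finiteT m2.
exists (fun n => F n `*` G n).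
  rewrite -setXTT TF TG predeqE => -[x y]; split.
    move=> [/= [n _ Fnx] [k _ Gky]]; exists (maxn n k) => //; split.
    - by move: x Fnx; exact/subsetPset/ndF/leq_maxl.
    - by move: y Gky; exact/subsetPset/ndG/leq_maxr.
  by move=> [n _ []/= ? ?]; split; exists n.
move=> k; have [? ?] := Foo k; have [? ?] := Goo k.
split; first exact: measurableX.
by rewrite product_measure1E// lte_mul_pinfty// ge0_fin_numE.
Qed.

(* The proofs are arguments of the definition, so that the image measure
   canonically is a sigma-finite measure. *)
Section image_measure.
Context d1 d2 (T1 : measurableType d1) (T2 : measurableType d2) (R : realType).
Variables (f : T1 -> T2) (g : T2 -> T1).
Hypotheses (mf : measurable_fun setT f) (mg : measurable_fun setT g).
Hypothesis fK : cancel f g.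
Variable mu : {measure set T1 -> \bar R}.
Hypothesis mu_sf : sigma_finite setT mu.

Definition image_measure of measurable_fun setT f & measurable_fun setT g &
  cancel f g & sigma_finite setT mu : set T2 -> \bar R := pushforward mu f.

Local Notation nu := (image_measure mf mg fK mu_sf).

Let nu0 : nu set0 = 0%E.
Proof. by rewrite /image_measure /pushforward preimage_set0 measure0. Qed.

Let nu_ge0 A : (0 <= nu A)%E.
Proof. exact: measure_ge0. Qed.

Let nu_sigma_additive : semi_sigma_additive nu.
Proof.
move=> F mF tF mUF; rewrite /image_measure /pushforward preimage_bigcup.
apply: measure_semi_sigma_additive.
- by move=> n; rewrite -[X in measurable X]setTI; exact: mf.
- apply/trivIsetP => /= i j _ _ ij; rewrite -preimage_setI.
  by move/trivIsetP : tF => /(_ _ _ _ _ ij) ->//; rewrite preimage_set0.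
- by rewrite -preimage_bigcup -[X in measurable X]setTI; exact: mf.
Qed.

HB.instance Definition _ :=
  isMeasure.Build _ _ _ nu nu0 nu_ge0 nu_sigma_additive.

Let nu_sigma_finite : sigma_finite setT nu.
Proof.
have [F FT mF] := mu_sf.
exists (fun i => g @^-1` F i).
  by rewrite -preimage_bigcup -FT preimage_setT.
move=> i; have [mFi Fioo] := mF i; split.
  by rewrite -[X in measurable X]setTI; exact: mg.
rewrite /image_measure /pushforward (_ : f @^-1` _ = F i)//.
by apply/seteqP; split => x /=; rewrite fK.
Qed.

HB.instance Definition _ := Measure_isSigmaFinite.Build _ _ _ nu nu_sigma_finite.

End image_measure.

Section lebesgue_tuple.
Context {R : realType}.
Local Notation mR := (measurableTypeR R).

Definition tcons n (p : mR * n.-tuple mR) : n.+1.-tuple mR :=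
  [the n.+1.-tuple mR of p.1 :: p.2].

Definition tuncons n (t : n.+1.-tuple mR) : mR * n.-tuple mR :=
  (tnth t ord0, [tuple of behead t]).

Lemma measurable_tcons n : measurable_fun setT (@tcons n).
Proof. by apply: measurable_cons. Qed.

Lemma measurable_tuncons n : measurable_fun setT (@tuncons n).
Proof.
apply: measurable_fun_pair; first exact: measurable_tnth.
exact: measurable_behead.
Qed.

Lemma tconsK n : cancel (@tcons n) (@tuncons n).
Proof. by move=> [x t]; congr pair; apply/val_inj. Qed.

Fixpoint lebesgue_tuple n : {sigma_finite_measure set (n.-tuple mR) -> \bar R} :=
  if n is k.+1 then
    image_measure (@measurable_tcons k) (@measurable_tuncons k) (@tconsK k)
      (sigma_finite_product (@lebesgue_measure R) (lebesgue_tuple k))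
  else \d_[tuple].

End lebesgue_tuple.

Section lebesgue_rV.
Context {R : realType} {d : nat}.
Local Notation mR := (measurableTypeR R).

Definition rV_of_tuple (t : d.-tuple mR) : 'rV[R]_d := \row_i tnth t i.

Definition tuple_of_rV (x : 'rV[R]_d) : d.-tuple mR := [tuple x ord0 i | i < d].

Lemma rV_of_tupleK : cancel rV_of_tuple tuple_of_rV.
Proof. by move=> t; apply: eq_from_tnth => i; rewrite tnth_mktuple mxE. Qed.

Lemma measurable_tuple_of_rV : measurable_fun setT tuple_of_rV.
Proof.
apply/measurable_fun_tnthP => i.
rewrite (_ : _ \o _ = fun x : 'rV[R]_d => x ord0 i); last first.
  by apply/funext => x /=; rewrite tnth_mktuple.
apply: (measurability _ (measurable_realfun.RGenOpens.measurableE R)).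
move=> _ [_ [a [b ->]] <-]; rewrite setTI; apply: sub_sigma_algebra.
apply: open_comp; last exact: interval_open.
by move=> x _; exact: coord_continuous.
Qed.

Lemma measurable_rV_of_tuple : measurable_fun setT rV_of_tuple.
Proof.
apply: (@measurability _ _ _ _ _ _ (@open 'rV[R]_d)) => // _ [U oU <-]; rewrite setTI.
pose q (p : {ffun 'I_d -> rat} * nat) : 'rV[R]_d := \row_i ratr (p.1 i).
pose B p := [set t : d.-tuple mR |
  forall i, ball (q p ord0 i) p.2.+1%:R^-1 (tnth t i)].
rewrite (_ : _ @^-1` _ =
    \bigcup_(p in [set p | B p `<=` rV_of_tuple @^-1` U]) B p); last first.
  apply/seteqP; split => [t Ut|t [p]]; last by apply.
  have /nbhs_ballP[e /= e0 eU] : nbhs (rV_of_tuple t) U by exact: open_nbhs_nbhs.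
  have [k ke] : exists k : nat, k.+1%:R^-1 < e / 2.
    have := @near_infty_natSinv_lt R (PosNum (divr_gt0 e0 (ltr0n _ 2))).
    by move=> [k _ /(_ k (leqnn _))]; exists k.
  have k0 : 0 < k.+1%:R^-1 :> R by rewrite invr_gt0.
  have /choice[r rt] : forall i, exists r : rat,
      `|ratr r - tnth t i : R| < k.+1%:R^-1.
    move=> i.
    have : tnth t i - k.+1%:R^-1 < tnth t i + k.+1%:R^-1.
      by rewrite ltrBlDr -addrA ltrDl addr_gt0.
    move=> /rat_in_itvoo[r]; rewrite in_itv/= => rt; exists r.
    by rewrite ltr_distl.
  exists ([ffun i => r i], k) => [s /= Bs|i] /=; last first.
    by rewrite mxE ffunE; exact: rt.
  apply: eU; split => // j i; rewrite !mxE.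
  have ball_half (a b c : R) :
      `|c - a| < k.+1%:R^-1 -> `|c - b| < k.+1%:R^-1 -> ball a e b.
    by move=> ca cb; apply: (@ball_splitr _ _ c); exact: lt_trans ke.
  apply: (ball_half _ _ (ratr (r i))); first exact: rt.
  by move: (Bs i); rewrite mxE ffunE.
rewrite bigcup_mkcond; apply: countable_bigcupT_measurable.
  exact: countableP.
move=> p; case: ifPn => // _.
rewrite (_ : B p = \bigcap_(i in [set: 'I_d])
    ((fun t : d.-tuple mR => tnth t i) @^-1` ball (q p ord0 i) p.2.+1%:R^-1)).
  apply: fin_bigcap_measurable => // i _.
  rewrite -[X in measurable X]setTI; apply: measurable_tnth => //.
  exact: measurable_realfun.measurable_ball.
by apply/seteqP; split => [t Bt i _|t Bt i]; [exact: Bt|exact: (Bt i I)].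
Qed.

Definition lebesgue_rV : set 'rV[R]_d -> \bar R :=
  image_measure measurable_rV_of_tuple measurable_tuple_of_rV rV_of_tupleK
    (sigma_finiteT (lebesgue_tuple d)).

HB.instance Definition _ := SigmaFiniteMeasure.on lebesgue_rV.

End lebesgue_rV.

Section euclidean.
Context {R : realType} {d : nat}.
Implicit Types (x y z : 'rV[R]_d) (f : 'rV[R]_d -> R).

(* The library norm `|x| on 'rV[R]_d is the sup norm. *)
Definition enorm x : R := Num.sqrt (\sum_i x ord0 i ^+ 2).

Definition eball z (r : R) : set 'rV[R]_d := [set x | enorm (x - z) < r].

Definition enorm_infty : set_system 'rV[R]_d :=
  [set A | exists M : R, forall x, M < enorm x -> A x].

Global Instance enorm_infty_filter : Filter enorm_infty.
Proof.
split; first by exists 0.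
  move=> A B [M MA] [N NB]; exists (Num.max M N) => x.
  by rewrite gt_max => /andP[Mx Nx]; split; [exact: MA|exact: NB].
by move=> A B AB [M MA]; exists M => x /MA /AB.
Qed.

Definition grad f x : 'rV[R]_d := \row_i 'D_(delta_mx ord0 i) f x.

End euclidean.

Section potentials.
Context {R : realType} {d : nat}.
Local Open Scope ereal_scope.
Implicit Types W : 'rV[R]_d -> \bar R.
Local Notation mu := (@lebesgue_rV R d).

Definition upper_semicontinuous W := forall x a, W x < a%:E ->
  exists2 V, nbhs x V & forall y, V y -> W y < a%:E.

Definition locally_integrableE W :=
  forall K, compact K -> mu.-integrable K W.

Definition radially_increasing_off (r : R) W :=
  forall x y, (r <= enorm x)%R -> (enorm x < enorm y)%R -> W x < W y.

Definition C1_off_origin W := forall x, x != 0%R ->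
  [/\ W x \is a fin_num, differentiable (fine \o W) x &
      {for x, continuous (grad (fine \o W))}].

(* For a < 0; the library has 0 `^ a = 0. *)
Definition neg_power (r a : R) : \bar R :=
  if r == 0%R then +oo else (r `^ a)%:E.

Definition laplacian_eps (e : R) W (x : 'rV[R]_d) : \bar R :=
  if W x == +oo then -oo else
  (2 * (d%:R + 2) / e ^+ 2)%:E *
    ((mu (eball 0 e))^-1 *
       \int[mu]_(y in eball 0 e) W (x + y)%R - W x).

Definition laplacian0 W (x : 'rV[R]_d) : \bar R :=
  limf_einf (fun e : R => laplacian_eps e W x) 0^'+.

Definition repulsive (beta : R) W :=
  locally_integrableE W /\
  (exists delta C : R, [/\ (0 < delta)%R, (0 < C)%R &
    forall x, (0 < enorm x < delta)%R ->
      (C * enorm x `^ (- beta))%:E <= - laplacian0 W x]) /\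
  - laplacian0 W 0%R = +oo.

Definition energy W (rho : probability 'rV[R]_d R) : \bar R :=
  2^-1%:E * \int[rho]_x \int[rho]_y W (x - y)%R.

Definition discrete_energy W N (X : 'I_N -> 'rV[R]_d) : \bar R :=
  (2 * N%:R ^+ 2)^-1%:E * \sum_(i < N) \sum_(j < N | j != i) W (X i - X j)%R.

End potentials.

Section empirical.
Context {R : realType} {d n : nat}.
Variable X : 'I_n.+1 -> 'rV[R]_d.
Local Open Scope ereal_scope.

Definition empirical : set 'rV[R]_d -> \bar R :=
  fun A => n.+1%:R^-1%:E * \sum_(i < n.+1) \d_(X i) A.

Let empirical0 : empirical set0 = 0.
Proof. by rewrite /empirical big1 ?mule0// => i _; rewrite measure0. Qed.

Let empirical_ge0 A : 0 <= empirical A.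
Proof. by apply: mule_ge0; [rewrite lee_fin invr_ge0|exact: sume_ge0]. Qed.

Let empirical_sigma_additive : semi_sigma_additive empirical.
Proof.
move=> F mF tF mUF; rewrite [X in _ --> X](_ : _ =
    lim ((fun k => \sum_(0 <= i < k) empirical (F i)) @ \oo)).
  by apply: is_cvg_ereal_nneg_natsum => k _; exact: empirical_ge0.
rewrite nneseriesZl//; last by move=> k _; exact: sume_ge0.
congr (_ * _); rewrite nneseries_sum//; apply: eq_bigr => /= i _.
exact: measure_semi_bigcup.
Qed.

HB.instance Definition _ := isMeasure.Build _ _ _ empirical
  empirical0 empirical_ge0 empirical_sigma_additive.

Let empirical_setT : empirical setT = 1.
Proof.
rewrite /empirical (eq_bigr (fun=> 1%E)); last by move=> i _; rewrite diracT.
rewrite sumEFin sumr_const card_ord -EFinM mulVf//.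
Qed.

HB.instance Definition _ :=
  Measure_isProbability.Build _ _ _ empirical empirical_setT.

End empirical.

Section narrow.
Context {R : realType} {d : nat}.
Local Open Scope ereal_scope.
Implicit Type rho : probability 'rV[R]_d R.

Definition narrow_cvg (mu : nat -> probability 'rV[R]_d R) rho :=
  forall phi : 'rV[R]_d -> R, continuous phi -> bounded_fun phi ->
    \int[mu n]_x (phi x)%:E @[n --> \oo] --> \int[rho]_x (phi x)%:E.

(* A family indexed by N >= 2 is a sequence indexed by n, with N = n.+2. *)
Definition gamma_cvg (EN : forall N, ('I_N -> 'rV[R]_d) -> \bar R)
    (E : probability 'rV[R]_d R -> \bar R) (A : set (probability 'rV[R]_d R)) :=
  forall rho, A rho ->
    (forall X : forall n, 'I_n.+2 -> 'rV[R]_d,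
      narrow_cvg (fun n => empirical (X n)) rho ->
      E rho <= limn_einf (fun n => EN n.+2 (X n))) /\
    (exists2 X : forall n, 'I_n.+2 -> 'rV[R]_d,
      narrow_cvg (fun n => empirical (X n)) rho &
      limn_esup (fun n => EN n.+2 (X n)) <= E rho).

(* The variation |nu| does not depend on the Hahn decomposition, which exists
   (Hahn_decomposition). *)
Definition morrey (p : \bar R) (nu : {charge set 'rV[R]_d -> \bar R}) :=
  exists2 M : R, (0 < M)%R &
    forall P N (nuPN : hahn_decomposition nu P N) (r : R) (x : 'rV[R]_d),
      (0 < r)%R ->
      charge_variation nuPN (eball x r) <=
        (M * r `^ (d%:R * fine (hoelder_conjugate p)^-1%E))%:E.

Definition morrey_probability (p : \bar R) : set (probability 'rV[R]_d R) :=
  [set rho | morrey p (charge_of_finite_measure rho)].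

End narrow.

(* Main.v *)
(* Only lower semicontinuity and boundedness below of W matter: the diagonal
   terms are dropped from E_N, and Gamma-convergence holds on all probability
   measures.

   Nonnegative lower semicontinuous functions are increasing limits of finite
   maxima of rational cones, which are Lipschitz, bounded, and countably many;
   they determine narrow convergence. For the liminf inequality, replace W by
   such a maximum g. The functions f_n(x) = \int g(x - y) dmu_n(y) are
   equi-Lipschitz, so inf_{n >= m} f_n is lower semicontinuous, and it increases
   to \int g(x - y) drho(y); passing to the limit in n, m, and then g suffices.

   For the recovery sequence, sample N points independently from rho: the mean
   of E_N is (N - 1)/N E(rho), and the mean squared discrepancy against
   normalised, 2^-k-weighted test functions is O(1/N). Averaging E_N plus
   sqrt N times the discrepancy gives one configuration good for both. If
   E(rho) is infinite, only the discrepancy is needed. *)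
Require Import Defs.
From mathcomp Require Import all_boot all_order all_algebra.
From mathcomp Require Import all_classical all_reals all_analysis.
From mathcomp Require Import ring lra measurable_realfun.

Set Implicit Arguments.
Unset Strict Implicit.
Unset Printing Implicit Defensive.
Import Order.TTheory GRing.Theory Num.Theory.
Import numFieldNormedType.Exports.
Local Open Scope classical_set_scope.
Local Open Scope ring_scope.
Local Open Scope ereal_scope.

(** Reduces the comparison of possibly infinite limits and energies to real thresholds. *)
Lemma lee_lt_real (R : realType) (x y : \bar R) :
  (forall b : R, b%:E < x -> b%:E <= y) -> x <= y.
Proof.
move=> h; rewrite leNgt; apply/negP => yx.
have [b yb bx] : exists2 b : R, y < b%:E & b%:E < x.
  case: x y yx {h} => [x| |] [y| |] //=.
  - rewrite lte_fin => yx; exists ((y + x) / 2)%R; rewrite lte_fin.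
      exact: (midf_lt yx).1.
    exact: (midf_lt yx).2.
  - by move=> _; exists (x - 1)%R; rewrite ?ltNyr// lte_fin gtrBl.
  - by move=> _; exists (y + 1)%R; rewrite ?ltry// lte_fin ltrDl.
  - by move=> _; exists 0%R; rewrite ?ltNyr ?ltry.
by move: (h _ bx); rewrite leNgt yb.
Qed.

(** * Lower semicontinuous functions as limits of maxima of rational cones *)

Section tents.
Context {R : realType} {d : nat}.
Local Open Scope ring_scope.
Local Notation rV := 'rV[R]_d.

(** The apex lies over the rational point [t.1.1] at rational height [t.1.2], and the slope [t.2] is
    a natural number, so the index type is countable. *)
Definition cone (t : {ffun 'I_d -> rat} * rat * nat) (x : rV) : R :=
  ratr t.1.2 - t.2%:R * `|x - \row_i ratr (t.1.1 i)|.

(** Starting the maximum at 0 makes every tent nonnegative. Finite lists of indices are still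
    countable, so [pickle] can number the test functions. *)
Definition tent (s : seq ({ffun 'I_d -> rat} * rat * nat)) (x : rV) : R :=
  \big[Num.max/0]_(t <- s) cone t x.

Lemma tent_ge0 s x : 0 <= tent s x.
Proof. exact: bigmax_ge_id. Qed.

Lemma tent_bounded s : exists2 B : R, 0 <= B & forall x, tent s x <= B.
Proof.
exists (\big[Num.max/0]_(t <- s) ratr t.1.2); first exact: bigmax_ge_id.
move=> x; rewrite /tent; elim/big_ind2 : _ => // [a b c e|t _].
  by rewrite ge_max !le_max => -> ->; rewrite orbT.
by rewrite gerBl mulr_ge0.
Qed.

Lemma tent_lipschitz s :
  exists2 L : R, 0 <= L & forall x y, tent s x <= tent s y + L * `|x - y|.
Proof.
elim: s => [|t s [L L0 HL]].
  by exists 0 => // x y; rewrite /tent !big_nil mul0r addr0.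
(* The sum of all slopes is a Lipschitz constant for the maximum. *)
exists (L + t.2%:R); first by rewrite addr_ge0.
move=> x y; rewrite /tent !big_cons -/(tent _ _) -/(tent _ _).
rewrite ge_max; apply/andP; split; last first.
  apply: (le_trans (HL x y)); apply: lerD; first by rewrite le_max lexx orbT.
  by rewrite ler_wpM2r// lerDl.
apply: (@le_trans _ _ (cone t y + (L + t.2%:R) * `|x - y|)); last first.
  by rewrite lerD2r le_max lexx.
have tri : `|y - \row_i ratr (t.1.1 i)| <= `|x - \row_i ratr (t.1.1 i)| + `|x - y|.
  by rewrite [leRHS]addrC (distrC x y); exact: ler_distD.
have t0 : 0 <= t.2%:R :> R by [].
have := ler_wpM2l t0 tri; have := mulr_ge0 L0 (normr_ge0 (x - y)).
by rewrite /cone; lra.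
Qed.

Lemma rV_rat_dense (x : rV) (e : R) : 0 < e ->
  exists q : {ffun 'I_d -> rat}, `|x - \row_i ratr (q i)| < e.
Proof.
move=> e0.
have /choice[q qx] : forall i, exists r : rat, `|x ord0 i - ratr r| < e.
  move=> i; have : x ord0 i - e < x ord0 i + e by rewrite ltrD2l gt0_cp.
  by move=> /rat_in_itvoo[r]; rewrite in_itv/= => rt; exists r;
    rewrite distrC ltr_distl.
exists [ffun i => q i].
have : ball x e (\row_i ratr ([ffun i => q i] i)).
  by split => // i j; rewrite !mxE !ffunE ord1; exact: qx.
by rewrite -ball_normE.
Qed.

(** By semicontinuity [f] exceeds a rational height [a > b] on a ball around [x]. A cone of height
    [a] with apex over a point close to [x], steep enough to be nonpositive outside that ball, lies
    below [f] everywhere because [f] is nonnegative. *)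
Lemma lsc_gt_cone (f : rV -> \bar R) x (b : R) :
  lower_semicontinuous f -> (forall y, 0 <= f y)%E ->
  0 <= b -> (b%:E < f x)%E ->
  exists t, (forall y, ((cone t y)%:E <= f y)%E) /\ b < cone t x.
Proof.
move=> lscf f0 b0 bfx.
have [a ba afx] : exists2 a : rat, b < ratr a & ((ratr a)%:E < f x)%E.
  case: (f x) bfx => [r| |]; rewrite ?lte_fin//.
    move=> /rat_in_itvoo[a]; rewrite in_itv/= => /andP[ba ar].
    by exists a.
  move=> _; have /rat_in_itvoo[a] : b < b + 1 by rewrite ltrDl.
  by rewrite in_itv/= => /andP[ba _]; exists a => //; rewrite ltry.
have [V /nbhs_ballP[r /= r0 rV] Vf] := lscf _ _ afx.
have a0 : 0 < ratr a :> R by exact: le_lt_trans ba.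
(* This slope brings the cone down to 0 within distance [r / 2] of its centre. *)
have [j jar] : exists j : nat, 2 * ratr a / r < j%:R :> R.
  by exists (Num.bound (2 * ratr a / r)); apply: archi_boundP;
    rewrite divr_ge0// ltW// mulr_gt0.
have j0 : 0 < j%:R :> R by apply: le_lt_trans jar; rewrite divr_ge0 ?ltW// mulr_gt0.
(* [r / 2] keeps the positive part of the cone inside the ball of radius [r]; the other bound keeps
   its value at [x] above [b]. *)
pose e := Num.min (r / 2) ((ratr a - b) / j%:R).
have e0 : 0 < e by rewrite lt_min !divr_gt0// subr_gt0.
have [q qx] := rV_rat_dense x e0.
exists (q, a, j); split; last first.
  move: qx; rewrite /cone/= lt_min => /andP[_].
  by rewrite ltr_pdivlMr// => h; lra.
move=> y; rewrite /cone/=;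
  case: (ltP 0 (ratr a - j%:R * `|y - \row_i ratr (q i)|)); last first.
  by move=> h; apply: le_trans (f0 y); rewrite lee_fin.
rewrite subr_gt0 => jya.
apply: (@le_trans _ _ (ratr a)%:E); first by rewrite lee_fin gerBl mulr_ge0.
apply/ltW/Vf/rV; rewrite -ball_normE /=.
rewrite (le_lt_trans (ler_distD (\row_i ratr (q i)) _ _))// [ltRHS]splitr ltrD//.
  by move: qx; rewrite lt_min => /andP[].
rewrite distrC; rewrite -(ltr_pM2l j0) (lt_trans jya)//.
by move: jar; rewrite ltr_pdivrMr// => h; rewrite mulrA ltr_pdivlMr// mulrC.
Qed.

Lemma lsc_tent_lim (f : rV -> \bar R) :
  lower_semicontinuous f -> (forall x, 0 <= f x)%E ->
  exists s : nat -> seq ({ffun 'I_d -> rat} * rat * nat),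
    [/\ forall x, nondecreasing_seq (fun m => tent (s m) x),
        forall m x, ((tent (s m) x)%:E <= f x)%E &
        forall x, (tent (s m) x)%:E @[m --> \oo] --> f x].
Proof.
move=> lscf f0.
(* The cones below [f] with code less than [m]; the list grows with [m], hence the monotonicity. *)
pose s m := [seq t <- pmap unpickle (iota 0 m) |
  `[< forall y, ((cone t y)%:E <= f y)%E >]].
have nds x : nondecreasing_seq (fun m => tent (s m) x).
  move=> m n mn; rewrite /tent /s; apply: sub_bigmax_seq => t.
  rewrite !mem_filter => /andP[-> /=].
  rewrite !mem_pmap => /mapP[k]; rewrite mem_iota add0n => /andP[_ km] ->.
  by apply: map_f; rewrite mem_iota/= add0n (leq_trans km).
have sf m x : ((tent (s m) x)%:E <= f x)%E.
  suff : forall u, all (fun t => `[< forall y, ((cone t y)%:E <= f y)%E >]) u ->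
      ((tent u x)%:E <= f x)%E by apply; exact: filter_all.
  elim=> [_|t u ih /= /andP[/asboolP tf /ih uf]].
    by rewrite /tent big_nil; exact: f0.
  by rewrite /tent big_cons EFin_max ge_max tf.
exists s; split => // x.
rewrite (_ : f x = ereal_sup (range (fun m => (tent (s m) x)%:E))).
  by apply: ereal_nondecreasing_cvgn => m n mn; rewrite lee_fin; exact: nds.
apply/eqP; rewrite eq_le; apply/andP; split; last first.
  apply: ge_ereal_sup => _ [m _ <-].
  exact: sf.
apply: lee_lt_real => b bfx; case: (leP 0 b) => [b0|/ltW b0]; last first.
  apply: (@le_trans _ _ (tent (s 0%N) x)%:E); last by apply: ereal_sup_ubound;
    exists 0%N.
  by rewrite lee_fin (le_trans b0)// tent_ge0.
have [t [tf bt]] := lsc_gt_cone lscf f0 b0 bfx.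
(* [iota 0 m] stops before [m], hence the successor. *)
apply: (@le_trans _ _ (tent (s (pickle t).+1) x)%:E).
  rewrite lee_fin (le_trans (ltW bt))// /tent (@le_bigmax_seq _ _ _ _ _ t)//.
  rewrite mem_filter asboolT// andTb mem_pmap; apply/mapP; exists (pickle t);
    rewrite ?pickleK//.
  by rewrite mem_iota add0n leq0n ltnSn.
by apply: ereal_sup_ubound; exists (pickle t).+1.
Qed.
End tents.

(** * Integrals against a probability and choice of points below the mean *)

Section probability_integral.
Context d (T : measurableType d) (R : realType) (P : probability T R).

(** A function exceeding its finite mean everywhere would leave a nonnegative difference with zero
    integral, hence zero almost everywhere, against total mass 1. *)
Lemma exists_le_integral (f : T -> \bar R) :
  measurable_fun setT f -> (forall x, 0 <= f x) ->
  exists y, f y <= \int[P]_x f x.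
Proof.
move=> mf f0.
(* Total mass 1 makes [T] inhabited, which gives the witness when the integral is [+oo]. *)
have [y0|T0] := pselect (exists y : T, True); last first.
  have : P setT = 1 by exact: probability_setT.
  rewrite (_ : setT = set0) ?measure0; last first.
    by apply/seteqP; split => // x _; apply: T0; exists x.
  by move/eqP; rewrite eq_sym onee_eq0.
have If0 : 0 <= \int[P]_x f x by exact: integral_ge0.
have [If|If] := eqVneq (\int[P]_x f x) +oo.
  by have [y _] := y0; exists y; rewrite If leey.
have Iffin : \int[P]_x f x \is a fin_num by rewrite ge0_fin_numE// ltey.
apply: contrapT => /forallNP nf.
set I := \int[P]_x f x in If0 If Iffin nf.
have ltf x : I < f x by rewrite ltNge; apply/negP/nf.
have mg : measurable_fun setT (fun x => f x - I).
  by apply: emeasurable_funB => //; exact: measurable_cst.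
have g0 x : 0 <= f x - I by rewrite sube_ge0 ?Iffin ?ltW.
have Ig : \int[P]_x (f x - I) = 0.
  have : \int[P]_x (f x - I + I) = I by apply: eq_integral => x _; rewrite subeK.
  rewrite ge0_integralD//.
  rewrite integral_cst// [X in _ * X]probability_setT mule1 => h.
  by have := congr1 (fun z => z - I) h; rewrite /= addeK// subee.
have : \int[P]_x `|f x - I| = 0.
  by rewrite -Ig; apply: eq_integral => x _; rewrite gee0_abs.
move/ae_eq_integral_abs => /(_ measurableT mg) [A [mA PA0 AT]].
have : P setT = 0.
  rewrite (_ : setT = A)//; apply/esym; rewrite -subTset => x _;
    apply: AT => /= /(_ Logic.I) fxI.
  by have := ltf x; rewrite -[f x](subeK _ Iffin) fxI add0e ltxx.
by rewrite [LHS]probability_setT => /eqP; rewrite onee_eq0.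
Qed.

(** The integral of [f] may be [+oo]. The negative part is at most [b], hence has finite integral,
    and [f + b + f^\- = f^\+ + b] equates sums of nonnegative functions, for which additivity
    holds. *)
Lemma integralD_cst (f : T -> \bar R) (b : R) :
  measurable_fun setT f -> (0 <= b)%R -> (forall x, 0 <= f x + b%:E) ->
  \int[P]_x (f x + b%:E) = \int[P]_x f x + b%:E.
Proof.
move=> mf b0 fb.
have fNb x : f^\- x <= b%:E.
  rewrite unlock ge_max lee_fin b0 andbT.
  by rewrite leeNl -sube_ge0 ?orbT// oppeK.
have If : \int[P]_x f^\- x \is a fin_num.
  rewrite ge0_fin_numE; last exact: integral_ge0.
  apply: (@le_lt_trans _ _ (\int[P]_x b%:E)); last first.
    by rewrite integral_cst// [X in _ * X]probability_setT mule1 ltry.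
  by apply: ge0_le_integral => //; exact: measurable_funeneg.
have mfb : measurable_fun setT (fun x => f x + b%:E).
  by apply: emeasurable_funD => //; exact: measurable_cst.
have : \int[P]_x (f x + b%:E + f^\- x) = \int[P]_x (f^\+ x + b%:E).
  apply: eq_integral => x _;
    have -> : f x = f^\+ x - f^\- x by rewrite {1}(funeposneg f).
  rewrite addeAC subeK//.
  by rewrite ge0_fin_numE// (le_lt_trans (fNb x))// ltry.
rewrite [X in X = _]ge0_integralD//; last exact: measurable_funeneg.
rewrite [X in _ = X]ge0_integralD//; last exact: measurable_funepos.
rewrite integral_cst// [X in _ * X]probability_setT mule1 => h.
by rewrite [in RHS]integralE addeAC -h addeK.
Qed.

Lemma cvg_integral_nd (f : nat -> T -> \bar R) (g : T -> \bar R) :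
  (forall n, measurable_fun setT (f n)) -> (forall n x, 0 <= f n x) ->
  (forall x, {homo f ^~ x : m n / (m <= n)%N >-> m <= n}) ->
  (forall x, f n x @[n --> \oo] --> g x) ->
  \int[P]_x f n x @[n --> \oo] --> \int[P]_x g x.
Proof.
move=> mf f0 ndf fg.
rewrite (_ : \int[P]_x g x = \int[P]_x (limn (f ^~ x))).
  by apply: cvg_monotone_convergence.
by apply: eq_integral => x _; apply/esym/cvg_lim.
Qed.

(* Conditional expectations, one coordinate at a time: averaging over the first
   point turns its interaction with the others into a one-body term. *)
Lemma exists_sum_le_integral n (u : T -> \bar R) (V : T * T -> \bar R) :
  measurable_fun setT u -> (forall x, 0 <= u x) ->
  measurable_fun setT V -> (forall z, 0 <= V z) ->
  exists X : 'I_n -> T,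
    \sum_(i < n) u (X i) + \sum_(i < n) \sum_(j < n | j != i) V (X i, X j) <=
    \sum_(i < n) \int[P]_x u x +
    \sum_(i < n) \sum_(j < n | j != i) \int[P]_x \int[P]_y V (x, y).
Proof.
move=> mu u0 mV V0; elim: n u mu u0 => [|n ih] u mu u0.
  have X : 'I_0 -> T by case.
  by exists X; rewrite !big_ord0.
(* Splits off the ordered pairs that contain the index 0. *)
have pairs (a : 'I_n.+1 -> 'I_n.+1 -> \bar R) :
    \sum_(i < n.+1) \sum_(j < n.+1 | j != i) a i j =
    \sum_(i < n) (a ord0 (lift ord0 i) + a (lift ord0 i) ord0) +
    \sum_(i < n) \sum_(j < n | j != i) a (lift ord0 i) (lift ord0 j).
  rewrite big_ord_recl big_split/= -addeA; congr (_ + _).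
    by rewrite big_mkcond big_ord_recl/= add0e.
  rewrite -big_split/=; apply: eq_bigr => i _.
  rewrite big_mkcond big_ord_recl/=; congr (_ + _).
  by rewrite [RHS]big_mkcond/=; apply: eq_bigr => j _; rewrite (inj_eq lift_inj).
pose K := \int[P]_x \int[P]_y V (x, y).
pose V1 y := \int[P]_x V (x, y).
pose V2 x := \int[P]_y V (x, y).
have mV1 : measurable_fun setT V1 by exact: measurable_fun_fubini_tonelli_G.
have mV2 : measurable_fun setT V2 by exact: measurable_fun_fubini_tonelli_F.
have V10 y : 0 <= V1 y by exact: integral_ge0.
have V20 y : 0 <= V2 y by exact: integral_ge0.
have I1 : \int[P]_y V1 y = K by rewrite /V1 -fubini_tonelli.
have mV12 : measurable_fun setT (fun y => V2 y + V1 y) by exact: emeasurable_funD.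
(* [V2 y + V1 y] is the mean interaction, in both orders, of a point at [y] with one sampled point;
   [n] points remain to be chosen. *)
have [y hy] : exists y, u y + \sum_(i < n) (V2 y + V1 y) <=
    \int[P]_x (u x + \sum_(i < n) (V2 x + V1 x)).
  apply: (@exists_le_integral (fun y => u y + \sum_(i < n) (V2 y + V1 y))).
    by apply: emeasurable_funD => //; exact: emeasurable_sum.
  by move=> y; rewrite adde_ge0// sume_ge0// => i _; exact: adde_ge0.
have mVl : measurable_fun setT (fun x => V (y, x)).
  by apply: (measurableT_comp mV); exact: measurable_pair1.
have mVr : measurable_fun setT (fun x => V (x, y)).
  by apply: (measurableT_comp mV); exact: measurable_pair2.
have mVlr : measurable_fun setT (fun x => V (y, x) + V (x, y)) by exact: emeasurable_funD.
(* The chosen point [y] acts on the others as an external potential, which is why the induction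
   generalises [u]. *)
have [||X hX] := ih (fun x => u x + (V (y, x) + V (x, y))).
- exact: emeasurable_funD.
- by move=> x; rewrite !adde_ge0.
exists (fun i => oapp X y (unlift ord0 i)).
rewrite !pairs [X in X + _ <= _]big_ord_recl [X in _ <= X + _]big_ord_recl /= unlift_none /=.
under eq_bigr do rewrite liftK /=.
under [X in _ + (X + _)]eq_bigr do rewrite liftK /=.
under [X in _ + (_ + X)]eq_bigr do (under eq_bigr do rewrite !liftK /=).
rewrite -/K -addeA [X in _ + X]addeA -[X in _ + (X + _)]big_split/=.
apply: (le_trans (leeD2l _ hX)).
have -> : \sum_(i < n) \int[P]_x (u x + (V (y, x) + V (x, y))) =
    \sum_(i < n) \int[P]_x u x + \sum_(i < n) (V2 y + V1 y).
  rewrite -big_split/=; apply: eq_bigr => i _.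
  rewrite ge0_integralD//; last by move=> x _; exact: adde_ge0.
  by rewrite ge0_integralD.
rewrite -/K addeA [X in _ + X + _]addeC addeA.
apply: (le_trans (leeD2r _ (leeD2r _ hy))).
rewrite ge0_integralD//; last 2 first.
- by move=> x _; rewrite sume_ge0// => i _; exact: adde_ge0.
- exact: emeasurable_sum.
rewrite ge0_integral_sum//; last by move=> i x _; exact: adde_ge0.
under [X in _ + X + _ + _]eq_bigr do rewrite ge0_integralD//.
by rewrite I1 -/K [X in X + _ <= _]addeAC -[leLHS]addeA.
Qed.
End probability_integral.

(** * Narrow convergence tested on tents *)

Section narrow_convergence.
Context {R : realType} {d : nat}.
Local Notation rV := 'rV[R]_d.

Lemma lsc_measurable (f : rV -> \bar R) :
  lower_semicontinuous f -> measurable_fun setT f.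
Proof.
move=> /lower_semicontinuousP lscf.
apply: (measurability _ (ErealGenOInfty.measurableE R)).
move=> /= _ [_ [a ->]] <-; rewrite setTI preimage_itvoy.
exact: sub_sigma_algebra.
Qed.

Lemma continuous_lsc (phi : rV -> R) :
  continuous phi -> lower_semicontinuous (fun x => (phi x)%:E).
Proof.
move=> cphi x a; rewrite lte_fin => ax.
by exists [set y | (a < phi y)%R]; [exact: cphi (lt_nbhsr ax)|].
Qed.

Lemma continuous_emeasurable (phi : rV -> R) :
  continuous phi -> measurable_fun setT (fun x => (phi x)%:E).
Proof. by move=> cphi; apply: lsc_measurable; exact: continuous_lsc. Qed.

(** The product sigma-algebra is not by definition the Borel one, so the proof goes through
    coordinates, where real subtraction is measurable. *)
Lemma measurable_rV_sub : measurable_fun setT (fun z : rV * rV => (z.1 - z.2)%R).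
Proof.
have -> : (fun z : rV * rV => (z.1 - z.2)%R) = rV_of_tuple \o
    (fun z => [tuple (tnth (tuple_of_rV z.1) i - tnth (tuple_of_rV z.2) i)%R | i < d]).
  by apply/funext => z /=; apply/rowP => i; rewrite !mxE !tnth_mktuple.
apply: measurableT_comp; first exact: measurable_rV_of_tuple.
apply/measurable_fun_tnthP => i.
rewrite (_ : _ \o _ = (fun z : rV * rV =>
    tnth (tuple_of_rV z.1) i - tnth (tuple_of_rV z.2) i)%R); last first.
  by apply/funext => z /=; rewrite tnth_mktuple.
have mi : measurable_fun setT (fun x : rV => tnth (tuple_of_rV x) i).
  by move/measurable_fun_tnthP : (@measurable_tuple_of_rV R d); exact.
by apply: measurable_funB; apply: measurableT_comp mi _.
Qed.

Lemma one_sided_lipschitz_continuous (f : rV -> R) (L : R) : (0 <= L)%R ->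
  (forall x y, f x <= f y + L * `|x - y|)%R -> continuous f.
Proof.
move=> L0 Lf.
move=> x; apply/(@cvgrPdist_lt _ R^o _ (nbhs x) (nbhs_filter x)) => e e0.
(* [L + 1] avoids a division by zero when [L = 0]. *)
have L1 : (0 < L + 1)%R by rewrite ltr_wpDl.
apply/nbhs_ballP; exists (e / (L + 1))%R => /=; first by rewrite divr_gt0.
move=> y; rewrite -ball_normE /= ltr_pdivlMr// => xy.
have := Lf x y; have := Lf y x; rewrite (distrC y x) => h1 h2.
have : (L * `|x - y| < e)%R by by have := normr_ge0 (x - y)%R; nra.
by rewrite ltr_norml; lra.
Qed.

Lemma tent_continuous s : continuous (@tent R d s).
Proof. by have [L L0 /(one_sided_lipschitz_continuous L0)] := @tent_lipschitz R d s. Qed.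

Lemma tent_measurable s : measurable_fun setT (fun x : rV => (tent s x)%:E).
Proof. by apply: continuous_emeasurable; exact: tent_continuous. Qed.

Implicit Types (mu : nat -> probability rV R) (rho : probability rV R).

Lemma narrow_cvg_tent mu rho s : narrow_cvg mu rho ->
  \int[mu n]_x (tent s x)%:E @[n --> \oo] --> \int[rho]_x (tent s x)%:E.
Proof.
apply; first exact: tent_continuous.
have [B B0 sB] := @tent_bounded R d s.
exists B; split; first exact: num_real.
move=> M BM x _ /=; rewrite ger0_norm ?tent_ge0//.
exact: le_trans (sB x) (ltW BM).
Qed.

(* The portmanteau inequality, from the countably many test functions tent s. *)
Lemma lt_integral_lsc mu rho (f : rV -> \bar R) (b : R) :
  (forall s, \int[mu n]_x (tent s x)%:E @[n --> \oo] -->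
             \int[rho]_x (tent s x)%:E) ->
  lower_semicontinuous f -> (forall x, 0 <= f x) ->
  b%:E < \int[rho]_x f x -> \forall n \near \oo, b%:E < \int[mu n]_x f x.
Proof.
move=> cvs lscf f0 bf.
have [s [nds lesf sf]] := lsc_tent_lim lscf f0.
have mf := lsc_measurable lscf.
have If : \int[rho]_x (tent (s m) x)%:E @[m --> \oo] --> \int[rho]_x f x.
  apply: cvg_integral_nd => [n|n x|x m n mn|x].
  - exact: tent_measurable.
  - by rewrite lee_fin tent_ge0.
  - by rewrite lee_fin; exact: nds.
  - exact: sf.
(* The strict bound is already reached by a single tent, whose integrals converge. *)
have [m bm] : exists m, b%:E < \int[rho]_x (tent (s m) x)%:E.
  have [m _ /(_ m (leqnn m))] := If _ (open_ereal_gt' bf).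
  by exists m.
have := cvs (s m) _ (open_ereal_gt' bm).
move=> [k _ kn]; exists k => // n /kn /= bn; apply: (lt_le_trans bn).
apply: ge0_le_integral => //.
- by move=> x _; rewrite lee_fin tent_ge0.
- exact: tent_measurable.
Qed.


(** For [phi] bounded by [M], both [phi + M] and [- phi + M] are continuous and nonnegative; the
    portmanteau inequality for the two bounds the integrals of [phi] from both sides. *)
Lemma narrow_cvg_of_tent mu rho :
  (forall s, \int[mu n]_x (tent s x)%:E @[n --> \oo] -->
             \int[rho]_x (tent s x)%:E) -> narrow_cvg mu rho.
Proof.
move=> cvs phi cphi [M0 [_ /(_ (`|M0| + 1)%R)]].
(* [bounded_fun] provides a bound at every real strictly above [M0]. *)
pose M := (`|M0| + 1)%R; rewrite -/M => bphi.
have M_ge0 : (0 <= M)%R by rewrite addr_ge0.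
have {}bphi x : (`|phi x| <= M)%R.
  by apply: bphi => //; rewrite (le_lt_trans (ler_norm _))// ltrDl.
have phiM x : (- M <= phi x <= M)%R by rewrite -ler_norml.
have cphiN : continuous (fun x => - phi x)%R by move=> x; exact/continuousN/cphi.
have mphi : measurable_fun setT (fun x => (phi x)%:E) by exact: continuous_emeasurable.
have mphiN : measurable_fun setT (fun x => (- phi x)%:E) by exact: continuous_emeasurable.
have phi0 x : 0 <= (phi x)%:E + M%:E by rewrite -EFinD lee_fin; have := phiM x; lra.
have phiN0 x : 0 <= (- phi x)%:E + M%:E by rewrite -EFinD lee_fin; have := phiM x; lra.
have iphi (P : probability rV R) : P.-integrable setT (EFin \o phi).
  apply: measurable_bounded_integrable => //.
  - by rewrite [X in X < _]probability_setT ltry.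
  - exact/measurable_EFinP.
  - exists M; split; first exact: num_real.
    by move=> N MN x _; exact: le_trans (bphi x) (ltW MN).
pose J (P : probability rV R) := fine (\int[P]_x (phi x)%:E).
have EJ (P : probability rV R) : \int[P]_x (phi x)%:E = (J P)%:E.
  by rewrite fineK//; apply: (integrable_fin_num _ (iphi P)).
have EJN (P : probability rV R) : \int[P]_x (- phi x)%:E = (- J P)%:E.
  by under eq_integral do rewrite EFinN; rewrite integralN ?EJ//;
    exact/integrable_add_def/iphi.
have lsc_shift (psi : rV -> R) : continuous psi ->
    lower_semicontinuous (fun x => (psi x)%:E + M%:E).
  move=> cpsi; apply: (@continuous_lsc (fun x => psi x + M)%R) => x.
  by apply: (@cvgD _ R^o _ (nbhs x)); [exact: cpsi|exact: cvg_cst].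
rewrite EJ; under eq_fun do rewrite EJ.
apply: cvg_EFin; first by apply: nearW.
apply/(@cvgrPdist_lt _ R^o) => e e0.
have h1 : \forall n \near \oo, (J rho + M - e)%:E < \int[mu n]_x ((phi x)%:E + M%:E).
  apply: lt_integral_lsc => //; first exact: lsc_shift.
  by rewrite integralD_cst// EJ lte_fin gtrBl.
have h2 : \forall n \near \oo, (- J rho + M - e)%:E < \int[mu n]_x ((- phi x)%:E + M%:E).
  apply: lt_integral_lsc => //; first exact: lsc_shift.
  by rewrite integralD_cst// EJN lte_fin gtrBl.
have [k _ kn] := filterI h1 h2; exists k => // n /kn [].
rewrite !integralD_cst// EJ EJN !lte_fin/= ltr_norml => ? ?.
by apply/andP; split; lra.
Qed.

Lemma integral_empirical n (X : 'I_n.+1 -> rV) (f : rV -> \bar R) :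
  measurable_fun setT f -> (forall x, 0 <= f x) ->
  \int[empirical X]_x f x = n.+1%:R^-1%:E * \sum_(i < n.+1) f (X i).
Proof.
move=> mf f0.
have n0 : (0 <= n.+1%:R^-1 :> R)%R by rewrite invr_ge0.
(* [msum] adds a sequence indexed by the naturals, so [X] is extended through [inord], the identity
   on the indices summed. *)
pose D i : {measure set rV -> \bar R} := \d_(X (inord i)).
rewrite (@eq_measure_integral _ _ _ setT (mscale (NngNum n0) (msum D n.+1)));
  last first.
  move=> A mA _; rewrite /= /empirical /mscale /msum/=; congr (_ * _).
  by apply: eq_bigr => i _; rewrite /D inord_val.
rewrite ge0_integral_mscale// ge0_integral_measure_sum//; congr (_ * _).
by apply: eq_bigr => i _; rewrite integral_dirac// diracT mul1e inord_val.
Qed.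

End narrow_convergence.

(** * Lower bounds for double integrals along a narrowly convergent sequence *)

Section liminf_inequality.
Context {R : realType} {d : nat}.
Local Notation rV := 'rV[R]_d.
Implicit Types (mu : nat -> probability rV R) (rho : probability rV R).

Lemma measurable_comp_sub (h : rV -> \bar R) : measurable_fun setT h ->
  measurable_fun setT (fun z : rV * rV => h (z.1 - z.2)%R).
Proof. by move=> mh; apply: (measurableT_comp mh); exact: measurable_rV_sub. Qed.

Lemma measurable_comp_subl (h : rV -> \bar R) x : measurable_fun setT h ->
  measurable_fun setT (fun y : rV => h (x - y)%R).
Proof.
move=> mh.
exact: (measurableT_comp (measurable_comp_sub mh) (pair1_measurable x)).
Qed.

Lemma measurable_convolution rho (h : rV -> \bar R) :
  measurable_fun setT h -> (forall x, 0 <= h x) ->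
  measurable_fun setT (fun x : rV => \int[rho]_y h (x - y)%R).
Proof.
move=> mh h0.
exact: (@measurable_fun_fubini_tonelli_F _ _ _ _ _ rho _ (measurable_comp_sub mh)).
Qed.

(** Integrand and measure both vary with [n]. A lower envelope of the inner integrals freezes the
    integrand, and the equi-Lipschitz bound makes the envelope lower semicontinuous. *)
Lemma lt_energy_tent mu rho s (b : R) : narrow_cvg mu rho ->
  b%:E < \int[rho]_x \int[rho]_y (tent s (x - y)%R)%:E ->
  \forall n \near \oo, b%:E < \int[mu n]_x \int[mu n]_y (tent s (x - y)%R)%:E.
Proof.
move=> cvmu bs.
have [L L0 Ls] := @tent_lipschitz R d s.
have [B B0 Bs] := @tent_bounded R d s.
have t0 x : 0 <= (tent s x : R)%:E by rewrite lee_fin tent_ge0.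
have mt := @tent_measurable R d s.
pose f n x := \int[mu n]_y (tent s (x - y)%R)%:E.
have f0 n x : 0 <= f n x by exact: integral_ge0.
have mf n : measurable_fun setT (f n) by exact: measurable_convolution mt _.
(* The constant does not depend on [n], since each [mu n] has mass 1. *)
have fL n x y : f n x <= f n y + (L * `|x - y|)%:E.
  have -> : f n y + (L * `|x - y|)%:E =
      \int[mu n]_z ((tent s (y - z)%R)%:E + (L * `|x - y|)%:E).
    rewrite integralD_cst ?mulr_ge0//; first exact: measurable_comp_subl mt.
    by move=> z; rewrite adde_ge0// lee_fin mulr_ge0.
  apply: ge0_le_integral => //.
  - exact: measurable_comp_subl mt.
  - by apply: emeasurable_funD; [exact: measurable_comp_subl mt|exact: measurable_cst].
  - move=> z _; rewrite -EFinD lee_fin (le_trans (Ls _ (y - z)%R))//.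
    by rewrite opprB addrA subrK.
have ff x : f n x @[n --> \oo] --> \int[rho]_y (tent s (x - y)%R)%:E.
  apply: cvmu.
    apply: (one_sided_lipschitz_continuous L0) => y z; have := Ls (x - y)%R (x - z)%R.
    by rewrite opprB [X in (`|X|)%R]addrC addrA subrK distrC.
  exists B; split; first exact: num_real.
  move=> M BM y _ /=; rewrite ger0_norm ?tent_ge0//.
  exact: le_trans (Bs _) (ltW BM).
(* The infimum over [n >= m]: a fixed function below every later [f n]. *)
pose F m x := einfs (f ^~ x) m.
have F0 m x : 0 <= F m x by apply: le_ereal_inf_tmp => _ [n _ <-].
have lscF m : lower_semicontinuous (F m).
  move=> x a aF.
  (* A real [c] strictly above [a] leaves room [c - a] for the Lipschitz loss, whatever the value of
     [F m x]. *)
  have [c ac cF] : exists2 c : R, (a < c)%R & c%:E < F m x.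
    case: (F m x) aF => [r| |]//.
      by rewrite lte_fin => ar; exists ((a + r) / 2)%R; rewrite ?lte_fin ?(midf_lt ar).
    by move=> _; exists (a + 1)%R; rewrite ?ltry// ltrDl.
  have L1 : (0 < L + 1)%R by rewrite ltr_wpDl.
  exists (ball_ Num.norm x ((c - a) / (L + 1))%R).
    by rewrite ball_normE; apply: nbhsx_ballx; rewrite divr_gt0// subr_gt0.
  move=> y xy0; have xy : (`|x - y| * (L + 1) < c - a)%R by rewrite -ltr_pdivlMr.
  apply: (@lt_le_trans _ _ (c - L * `|x - y|)%:E).
    by rewrite lte_fin; have := normr_ge0 (x - y)%R; nra.
  apply: le_ereal_inf_tmp => _ [n mn <-].
  rewrite EFinB leeBlDr// (le_trans _ (fL n x y))// (le_trans (ltW cF))//.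
  by apply: ereal_inf_lbound; exists n.
have IF : \int[rho]_x F m x @[m --> \oo] --> \int[rho]_x \int[rho]_y (tent s (x - y)%R)%:E.
  apply: cvg_integral_nd => //.
  - by move=> m; exact: lsc_measurable (lscF m).
  - by move=> x; exact: nondecreasing_einfs.
  - by move=> x; apply: cvg_einfs; exact: ff.
have [m bm] : exists m, b%:E < \int[rho]_x F m x.
  have [m _ /(_ m (leqnn m))] := IF _ (open_ereal_gt' bs).
  by exists m.
(* The portmanteau inequality for the single function [F m]; requiring [n >= m] afterwards returns
   to [f n]. *)
have h : \forall n \near \oo, b%:E < \int[mu n]_x F m x.
  by apply: lt_integral_lsc bm => // s'; exact: narrow_cvg_tent.
have [k _ kn] := h; exists (maxn k m) => // n /=.
rewrite geq_max => /andP[/kn /= bn mn]; apply: (lt_le_trans bn).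
apply: ge0_le_integral => //; [exact: lsc_measurable (lscF m)|exact: mf|].
by move=> x _; apply: ereal_inf_lbound; exists n.
Qed.

(** The conclusion keeps a tent instead of [h]: a tent is bounded, so its diagonal terms can be
    controlled even where [h] is [+oo] at 0. *)
Lemma lt_energy_lsc mu rho (h : rV -> \bar R) (b : R) :
  narrow_cvg mu rho -> lower_semicontinuous h -> (forall x, 0 <= h x) ->
  b%:E < \int[rho]_x \int[rho]_y h (x - y)%R ->
  exists2 s, (forall x, (tent s x)%:E <= h x) &
    \forall n \near \oo, b%:E < \int[mu n]_x \int[mu n]_y (tent s (x - y)%R)%:E.
Proof.
move=> cvmu lsch h0 bh.
have [s [nds sh cvs]] := lsc_tent_lim lsch h0.
have t0 m x : 0 <= (tent (s m) x : R)%:E by rewrite lee_fin tent_ge0.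
have I : \int[rho]_x \int[rho]_y (tent (s m) (x - y)%R)%:E @[m --> \oo] -->
    \int[rho]_x \int[rho]_y h (x - y)%R.
  apply: cvg_integral_nd.
  - by move=> m; apply: (measurable_convolution rho (tent_measurable (s m))).
  - by move=> m x; exact: integral_ge0.
  - move=> x m n mn; apply: ge0_le_integral => //.
    + exact: measurable_comp_subl (tent_measurable _).
    + exact: measurable_comp_subl (tent_measurable _).
    + by move=> y _; rewrite lee_fin; exact: nds.
  - move=> x; apply: cvg_integral_nd => //.
    + by move=> m; exact: measurable_comp_subl (tent_measurable _).
    + by move=> y m n mn; rewrite lee_fin; exact: nds.
have [m _ /(_ m (leqnn m)) bm] := I _ (open_ereal_gt' bh).
by exists (s m); [exact: sh|exact: lt_energy_tent bm].
Qed.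

Lemma double_integral_empirical n (X : 'I_n.+1 -> rV) (h : rV -> \bar R) :
  measurable_fun setT h -> (forall x, 0 <= h x) ->
  \int[empirical X]_x \int[empirical X]_y h (x - y)%R =
  (n.+1%:R ^- 2)%:E * \sum_(i < n.+1) \sum_(j < n.+1) h (X i - X j)%R.
Proof.
move=> mh h0.
rewrite integral_empirical; [|exact: measurable_convolution|by move=> x; exact: integral_ge0].
have e i : \int[empirical X]_y h (X i - y)%R =
    n.+1%:R^-1%:E * \sum_(j < n.+1) h (X i - X j)%R.
  by rewrite integral_empirical//; exact: measurable_comp_subl.
under eq_bigr do rewrite e.
rewrite -ge0_sume_distrr; last by move=> i _; exact: sume_ge0.
by rewrite muleA -EFinM -invfM expr2.
Qed.

End liminf_inequality.

(** * Shifted energies and the liminf inequality *)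

Section gamma_liminf.
Context {R : realType} {d : nat}.
Local Notation rV := 'rV[R]_d.
Implicit Types (rho : probability rV R) (W : rV -> \bar R).

Lemma limn_einf_ge (u : nat -> \bar R) (b : \bar R) :
  (\forall n \near \oo, b <= u n) -> b <= limn_einf u.
Proof.
move=> [k _ ku]; rewrite limn_einf_lim; apply: lime_ge; first exact: is_cvg_einfs.
exists k => // m /= km; apply: le_ereal_inf_tmp => _ [n /= mn <-].
by apply: ku => /=; exact: leq_trans mn.
Qed.

Lemma limn_esup_le (u : nat -> \bar R) (b : \bar R) :
  (\forall n \near \oo, u n <= b) -> limn_esup u <= b.
Proof.
move=> [k _ ku]; rewrite limn_esup_lim; apply: lime_le; first exact: is_cvg_esups.
exists k => // m /= km; apply: ge_ereal_sup => _ [n /= mn <-].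
by apply: ku => /=; exact: leq_trans mn.
Qed.

(** Both marginals have mass 1, so a shift of [W] by [b] comes out of the double integral and leaves
    a nonnegative kernel. *)
Lemma energyD_cst rho W (b : R) : measurable_fun setT W ->
  (0 <= b)%R -> (forall x, 0 <= W x + b%:E) ->
  energy W rho =
  2^-1%:E * (\int[rho]_x \int[rho]_y (W (x - y)%R + b%:E) - b%:E).
Proof.
move=> mW b0 W0; rewrite /energy; congr (_ * _).
have mWb : measurable_fun setT (fun x => W x + b%:E).
  by apply: emeasurable_funD => //; exact: measurable_cst.
have eW x : \int[rho]_y (W (x - y)%R + b%:E) = \int[rho]_y W (x - y)%R + b%:E.
  by rewrite integralD_cst//; exact: measurable_comp_subl.
under [in RHS]eq_integral do rewrite eW.
rewrite integralD_cst ?addeK//.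
(* Measurability is known for nonnegative kernels, so the inner integral is written as a shifted one
   minus [b]. *)
- have -> : (fun x : rV => \int[rho]_y W (x - y)%R) =
      (fun x : rV => \int[rho]_y (W (x - y)%R + b%:E) - b%:E).
    by apply/funext => x; rewrite eW addeK.
  apply: emeasurable_funB; last exact: measurable_cst.
  exact: (measurable_convolution rho mWb).
- by move=> x; rewrite -eW; exact: integral_ge0.
Qed.

Lemma sum_offdiag_cst n (b : R) :
  \sum_(i < n) \sum_(j < n | j != i) b%:E = (n%:R * n.-1%:R * b)%:E :> \bar R.
Proof.
under eq_bigr => i _.
  rewrite sumEFin sumr_const (_ : #|_| = n.-1); last by rewrite cardC1 card_ord.
  over.
by rewrite sumEFin sumr_const card_ord; congr EFin;
  rewrite -[RHS]mulrA [RHS]mulr_natl (mulr_natl b).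
Qed.

Lemma discrete_energyD_cst W (b : R) n (X : 'I_n -> rV) :
  discrete_energy W X = (2 * n%:R ^+ 2)^-1%:E *
  (\sum_(i < n) \sum_(j < n | j != i) (W (X i - X j)%R + b%:E) -
   (n%:R * n.-1%:R * b)%:E).
Proof.
rewrite /discrete_energy; congr (_ * _).
under [in RHS]eq_bigr do rewrite big_split/=.
by rewrite big_split/= sum_offdiag_cst addeK.
Qed.

Lemma near_natr_gt (a : R) : \forall n \near \oo, (a < n.+2%:R)%R.
Proof.
exists (Num.bound `|a|) => // n /= an.
have := archi_boundP (normr_ge0 a) => ha.
rewrite (le_lt_trans (ler_norm a))// (lt_le_trans ha)// ler_nat.
by rewrite (leq_trans an)// -addn2 leq_addr.
Qed.

(** The double integral of a tent against an empirical measure includes the diagonal, but this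
    contributes at most [B / N] and vanishes in the limit. *)
Lemma energy_le_limn_einf W rho (b : R) (X : forall n, 'I_n.+2 -> rV) :
  lower_semicontinuous W -> (0 <= b)%R -> (forall x, 0 <= W x + b%:E) ->
  narrow_cvg (fun n => empirical (X n)) rho ->
  energy W rho <= limn_einf (fun n => discrete_energy W (X n)).
Proof.
move=> lscW b0 W0 cvX; apply: lee_lt_real => a aE; apply: limn_einf_ge.
pose h x := W x + b%:E.
have lsch : lower_semicontinuous h.
  move=> x c ch; have [|V xV Vc] := lscW x (c - b)%R.
    by rewrite EFinB lteBlDr.
  by exists V => // y /Vc; rewrite EFinB lteBlDr.
(* [a < energy W rho] says that the shifted double integral exceeds [2 * a + b]; [c] leaves a
   margin. *)
have [c ac cI] : exists2 c : R, (2 * a + b < c)%R &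
    c%:E < \int[rho]_x \int[rho]_y h (x - y)%R.
  move: aE; rewrite (energyD_cst _ (lsc_measurable lscW) b0 W0).
  rewrite lte_pdivlMl// lteBrDr// -EFinM -EFinD.
  case: (X in _ < X) => [r| |]//; last first.
    by move=> _; exists (2 * a + b + 1)%R; rewrite ?ltry// ltrDl.
  by rewrite lte_fin => ar; exists ((2 * a + b + r) / 2)%R;
    rewrite ?lte_fin (midf_lt ar).
have [s sh [k _ kn]] := lt_energy_lsc cvX lsch W0 cI.
have [B B0 Bs] := @tent_bounded R d s.
(* Beyond this rank the diagonal share [B / N] is smaller than the margin. *)
have [l _ ln] := near_natr_gt (B / (c - (2 * a + b))).
exists (maxn k l) => // n /=; rewrite geq_max => /andP[/kn /= {}kn /ln /= {}ln].
rewrite (discrete_energyD_cst _ b); set H := (X in X - _).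
have N0 : (0 < n.+2%:R :> R)%R by [].
(* Off the diagonal the tent is at most [h]; each of the [N] diagonal terms is at most [B]. *)
have {}kn : (c * n.+2%:R ^+ 2)%:E < H + (n.+2%:R * B)%:E.
  move: kn; rewrite (@double_integral_empirical _ _ _ _ (fun x => (tent s x)%:E)); first last.
  - by move=> x; rewrite lee_fin tent_ge0.
  - exact: tent_measurable.
  rewrite lte_pdivlMl ?exprn_gt0// -EFinM mulrC => /lt_le_trans; apply.
  have -> : (n.+2%:R * B)%:E = \sum_(i < n.+2) B%:E.
    by rewrite sumEFin sumr_const card_ord mulr_natl.
  rewrite /H -big_split/=; apply: lee_sum => i _.
  rewrite (bigD1 i)//= addeC; apply: leeD; first by apply: lee_sum => j _; exact: sh.
  by rewrite lee_fin.
have : 0 <= H by do 2 (apply: sume_ge0 => ? _).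
(* An infinite off-diagonal sum makes the discrete energy [+oo]. *)
case: H kn => [H| |]// kn _;
  last by rewrite addye// gt0_muley ?leey// lte_fin invr_gt0 mulr_gt0// exprn_gt0.
rewrite -EFinB -EFinM lee_fin ler_pdivlMl ?mulr_gt0 ?exprn_gt0//.
move: kn ln; rewrite -EFinD lte_fin ltr_pdivrMr ?subr_gt0//= => kn ln.
have : (n.+1%:R = n.+2%:R - 1 :> R)%R by rewrite -[n.+2%:R]natr1 addrK.
move=> ->; move: (n.+2%:R : R)%R N0 kn ln => N N0 kn ln.
have : (N * B <= N * (N * (c - (2 * a + b))))%R by rewrite ler_wpM2l// ltW.
have := mulr_ge0 (ltW N0) b0.
by lra.
Qed.

End gamma_liminf.

(** * Configurations with small energy and small discrepancy *)

Section quantization.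
Context d (T : measurableType d) (R : realType) (P : probability T R).

Lemma sum_exp2N_le n : (\sum_(k < n) 2 ^- k <= 2 :> R)%R.
Proof.
suff -> : (\sum_(k < n) 2 ^- k = 2 - 2 * 2 ^- n :> R)%R by rewrite gerBl.
elim: n => [|n ih]; first by rewrite big_ord0 expr0 invr1 mulr1 subrr.
rewrite big_ord_recr/= ih exprS invfM.
by lra.
Qed.

Lemma integral_centered (phi : T -> R) (a c : R) :
  measurable_fun setT phi -> (forall x, `|phi x| <= 1)%R ->
  \int[P]_x (phi x)%:E = 0 -> \int[P]_x (c + a * phi x)%:E = c%:E.
Proof.
move=> mphi phi1 I0.
have iphi : P.-integrable setT (EFin \o phi).
  apply: measurable_bounded_integrable => //.
    by rewrite [X in X < _]probability_setT ltry.
  exists 1%R; split; first exact: num_real.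
  by move=> N N1 x _; exact: le_trans (phi1 x) (ltW N1).
under eq_integral do rewrite EFinD EFinM.
rewrite integralD//; last 2 first.
- exact: finite_measure_integrable_cst.
- exact: integrableZl.
by rewrite integralZl// I0 mule0 adde0 integral_cst// [X in _ * X]probability_setT mule1.
Qed.

(* The sum over k is the squared discrepancy of X against the test functions
   phi k; for independent samples its mean is only of order n. *)
Lemma exists_quantization n (V : T * T -> \bar R) (phi : nat -> T -> R) (I t : R) :
  measurable_fun setT V -> (forall z, 0 <= V z) ->
  \int[P]_x \int[P]_y V (x, y) = I%:E ->
  (forall k, measurable_fun setT (phi k)) -> (forall k x, `|phi k x| <= 1)%R ->
  (forall k, \int[P]_x (phi k x)%:E = 0) -> (0 <= t)%R ->
  exists X : 'I_n -> T,
    \sum_(i < n) \sum_(j < n | j != i) V (X i, X j) +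
    (t * \sum_(k < n) 2 ^- k * (\sum_(i < n) phi k (X i)) ^+ 2)%:E <=
    (n%:R ^+ 2 * I + 2 * t * n%:R)%:E.
Proof.
move=> mV V0 IV mphi phi1 Iphi t0.
have w0 k : (0 <= 2 ^- k :> R)%R by rewrite invr_ge0 exprn_ge0.
(* The constant [t * 2 ^- k] makes the kernel nonnegative, as [phi k] is bounded by 1; its total
   contribution later cancels on both sides. *)
pose K k (z : T * T) : R := (t * 2 ^- k + t * 2 ^- k * phi k z.1 * phi k z.2)%R.
have K0 k z : (0 <= K k z)%R.
  have a0 : (0 <= t * 2 ^- k)%R by rewrite mulr_ge0.
  have : (`|phi k z.1 * phi k z.2| <= 1)%R by rewrite normrM mulr_ile1.
  rewrite ler_norml => /andP[h _].
  have p0 : (0 <= 1 + phi k z.1 * phi k z.2)%R by lra.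
  have := mulr_ge0 a0 p0.
  by rewrite /K; lra.
have mK k : measurable_fun setT (fun z => (K k z)%:E).
  apply/measurable_EFinP; apply: measurable_funD; first exact: measurable_cst.
  apply: measurable_funM; last exact: measurableT_comp (mphi k) measurable_snd.
  apply: measurable_funM; first exact: measurable_cst.
  exact: measurableT_comp (mphi k) measurable_fst.
pose V' z := V z + \sum_(k < n) (K k z)%:E.
have mV' : measurable_fun setT V'.
  by apply: emeasurable_funD => //; apply: emeasurable_sum => k; exact: mK.
have SK0 z : 0 <= \sum_(k < n) (K k z)%:E by apply: sume_ge0 => k _; rewrite lee_fin.
have V'0 z : 0 <= V' z by rewrite adde_ge0.
pose S : R := (\sum_(k < n) t * 2 ^- k)%R.
have IV' : \int[P]_x \int[P]_y V' (x, y) = (I + S)%:E.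
  have inner x : \int[P]_y V' (x, y) = \int[P]_y V (x, y) + S%:E.
    rewrite ge0_integralD//; last 2 first.
    - exact: measurableT_comp mV (pair1_measurable x).
    - apply: emeasurable_sum => k.
      exact: measurableT_comp (mK k) (pair1_measurable x).
    congr (_ + _); rewrite ge0_integral_sum//; last 2 first.
    - by move=> k; exact: measurableT_comp (mK k) (pair1_measurable x).
    - by move=> k y _; rewrite lee_fin.
    rewrite -sumEFin; apply: eq_bigr => k _.
    (* For fixed [x] the product is a multiple of the centred [phi k], so only the constant
       survives. *)
    rewrite /K/=; exact: (integral_centered _ _ (mphi k) (phi1 k) (Iphi k)).
  under eq_integral do rewrite inner.
  rewrite ge0_integralD//; first last.
  - by move=> x _; rewrite lee_fin sumr_ge0// => k _; rewrite mulr_ge0.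
  - exact: measurable_fun_fubini_tonelli_F.
  - by move=> x _; exact: integral_ge0.
  by rewrite IV integral_cst// [X in _ * X]probability_setT mule1.
have [//|X] := @exists_sum_le_integral _ _ _ P n (cst 0) V' (measurable_cst _) _ mV' V'0.
rewrite [X in X + _ <= _]big1// add0e [X in _ <= X + _]big1; last first.
  by move=> i _; exact: integral0.
rewrite add0e IV' sum_offdiag_cst => hX; exists X.
have {hX} : \sum_(i < n) \sum_(j < n | j != i) V (X i, X j) +
    (\sum_(i < n) \sum_(j < n | j != i) \sum_(k < n) K k (X i, X j))%:E <=
    (n%:R * n.-1%:R * (I + S))%:E.
  apply: le_trans hX; rewrite -sumEFin -big_split/=; apply: lee_sum => i _.
  rewrite -sumEFin -big_split/=; apply: lee_sum => j _.
  by rewrite -sumEFin.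
(* The off-diagonal products sum to the square of the sum minus the sum of the squares. *)
have offdiag k : (\sum_(i < n) \sum_(j < n | j != i) K k (X i, X j) =
    n%:R * n.-1%:R * (t * 2 ^- k) + t * 2 ^- k *
    ((\sum_(i < n) phi k (X i)) ^+ 2 - \sum_(i < n) phi k (X i) ^+ 2))%R.
  have -> : (\sum_(i < n) \sum_(j < n | j != i) K k (X i, X j) =
      \sum_(i < n) \sum_(j < n | j != i) t * 2 ^- k +
      \sum_(i < n) \sum_(j < n | j != i) t * 2 ^- k * phi k (X i) * phi k (X j))%R.
    by rewrite -big_split/=; apply: eq_bigr => i _; rewrite -big_split.
  congr (_ + _)%R.
    apply: EFin_inj; rewrite -sum_offdiag_cst -sumEFin; apply: eq_bigr => i _.
    by rewrite sumEFin.
  rewrite expr2 mulr_suml -sumrB mulr_sumr; apply: eq_bigr => i _.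
  rewrite mulr_sumr [in RHS](bigD1 i)//= expr2 addrAC subrr add0r mulr_sumr.
  by apply: eq_bigr => j _; rewrite !mulrA.
have -> : (\sum_(i < n) \sum_(j < n | j != i) \sum_(k < n) K k (X i, X j) =
    n%:R * n.-1%:R * S + t * (\sum_(k < n) 2 ^- k * (\sum_(i < n) phi k (X i)) ^+ 2)
    - t * (\sum_(k < n) 2 ^- k * \sum_(i < n) phi k (X i) ^+ 2))%R.
  under eq_bigr do rewrite exchange_big/=.
  rewrite exchange_big/=; under eq_bigr do rewrite offdiag; rewrite big_split/=.
  rewrite -mulr_sumr -addrA; congr (_ + _)%R.
  rewrite !mulr_sumr -sumrB; apply: eq_bigr => k _.
  by rewrite mulrBr !mulrA.
set D := (\sum_(k < n) 2 ^- k * (\sum_(i < n) phi k (X i)) ^+ 2)%R.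
set Q := (\sum_(k < n) 2 ^- k * \sum_(i < n) phi k (X i) ^+ 2)%R.
(* The diagonal squares are at most 1 and the weights add up to at most 2; this is the source of
   [2 * t * n] in the bound. *)
have Q2 : (Q <= 2 * n%:R)%R.
  rewrite (le_trans _ (ler_wpM2r _ (sum_exp2N_le n)))// mulr_suml;
    apply: ler_sum => k _.
  rewrite ler_wpM2l//; apply: (@le_trans _ _ (\sum_(i < n) 1)%R).
    by apply: ler_sum => i _; rewrite -real_normK ?num_real// expr_le1.
  by rewrite sumr_const card_ord.
have I0 : (0 <= I)%R.
  by rewrite -lee_fin -IV; apply: integral_ge0 => x _; exact: integral_ge0.
case: (X in X + _) => [H| |]; [|by rewrite addye// leye_eq|by move=> _; rewrite addNye leNye].
rewrite -!EFinD !lee_fin => h.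
have : (n%:R * n.-1%:R * I <= n%:R ^+ 2 * I)%R.
  by rewrite ler_wpM2r// expr2 ler_wpM2l// ler_nat leq_pred.
have := ler_wpM2l t0 Q2.
by lra.
Qed.

End quantization.

(** * Recovery sequences and Gamma-convergence *)

Section gamma_convergence.
Context {R : realType} {d : nat}.
Local Notation rV := 'rV[R]_d.
Implicit Types (rho : probability rV R) (W : rV -> \bar R).

Lemma near_sqrt_natr_gt (a : R) :
  \forall n \near \oo, (a < Num.sqrt n.+2%:R)%R.
Proof.
have [k _ kn] := near_natr_gt (a ^+ 2); exists k => // n /kn /= an.
by rewrite (le_lt_trans (ler_norm a))// -sqrtr_sqr ltr_sqrt.
Qed.

(** With discrepancy weight [t = sqrt N], the excess [2 * t * N] is negligible against [N ^ 2],
    while the squared mean of the test function [k] is at most [2 ^ k * (I + 2) / sqrt N]. Both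
    errors tend to 0. *)
Lemma exists_recovery rho (h : rV -> \bar R) (I : R) :
  measurable_fun setT h -> (forall x, 0 <= h x) ->
  \int[rho]_x \int[rho]_y h (x - y)%R = I%:E ->
  exists X : forall n, 'I_n.+2 -> rV,
    narrow_cvg (fun n => empirical (X n)) rho /\
    forall e : R, (0 < e)%R -> \forall n \near \oo,
      \sum_(i < n.+2) \sum_(j < n.+2 | j != i) h (X n i - X n j)%R <=
      (n.+2%:R ^+ 2 * (I + e))%:E.
Proof.
move=> mh h0 Ih.
have I0 : (0 <= I)%R.
  by rewrite -lee_fin -Ih; apply: integral_ge0 => x _; exact: integral_ge0.
have /choice[B HB] : forall s, exists B : R, (0 <= B)%R /\ forall x : rV, (tent s x <= B)%R.
  by move=> s; have [B B0 sB] := @tent_bounded R d s; exists B.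
pose c s : R := fine (\int[rho]_x (tent s x)%:E).
have t0 s (x : rV) : (0 <= tent s x)%R by exact: tent_ge0.
have mt s : measurable_fun setT (tent s : rV -> R).
  by apply/measurable_EFinP; exact: tent_measurable.
have it s : rho.-integrable setT (EFin \o tent s).
  apply: measurable_bounded_integrable => //.
    by rewrite [X in X < _]probability_setT ltry.
  exists (B s); split; first exact: num_real.
  move=> N BN x _; rewrite /= ger0_norm//.
  exact: le_trans ((HB s).2 x) (ltW BN).
have Ec s : \int[rho]_x (tent s x)%:E = (c s)%:E.
  by rewrite fineK//; apply: (integrable_fin_num _ (it s)).
have c0 s : (0 <= c s)%R.
  by rewrite -lee_fin -Ec; apply: integral_ge0 => x _; rewrite lee_fin.
have cB s : (c s <= B s)%R.
  rewrite -lee_fin -Ec; apply: (@le_trans _ _ (\int[rho]_x (B s)%:E)).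
    apply: ge0_le_integral => //.
    - by move=> x _; rewrite lee_fin.
    - exact: tent_measurable.
    - by move=> x _; rewrite lee_fin; exact: (HB s).2.
  by rewrite integral_cst// [X in _ * X]probability_setT mule1.
have B1 s : (0 < 1 + B s)%R by rewrite ltr_pwDl//; exact: (HB s).1.
(* Centring and division by [1 + B s] meet the normalisation of [exists_quantization]; codes of no
   tent give 0. *)
pose phi k (x : rV) : R :=
  if unpickle k is Some s then ((tent s x - c s) / (1 + B s))%R else 0%R.
have mphi k : measurable_fun setT (phi k).
  rewrite /phi; case: (unpickle k) => [s|]; last exact: measurable_cst.
  apply: measurable_funM; last exact: measurable_cst.
  by apply: measurable_funB; [exact: mt|exact: measurable_cst].
have phi1 k x : (`|phi k x| <= 1)%R.
  rewrite /phi; case: (unpickle k) => [s|]; last by rewrite normr0.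
  rewrite normrM [X in (_ * X)%R]gtr0_norm ?invr_gt0// ler_pdivrMr// mul1r.
  by rewrite ler_norml; have := (HB s).2 x; have := t0 s x; have := c0 s;
    have := cB s; lra.
have Iphi k : \int[rho]_x (phi k x)%:E = 0.
  rewrite /phi; case: (unpickle k) => [s|]; last by rewrite integral0.
  under eq_integral do rewrite EFinM EFinB.
  have ic : rho.-integrable setT (fun x => (tent s x)%:E - (c s)%:E).
    exact: (integrableB measurableT (it s) (finite_measure_integrable_cst rho (c s) measurableT)).
  rewrite integralZr//.
  rewrite integralB//; [|exact: it|exact: finite_measure_integrable_cst].
  by rewrite Ec integral_cst// [X in _ - _ * X]probability_setT mule1 subee// mul0e.
have exX n : exists X : 'I_n.+2 -> rV,
    \sum_(i < n.+2) \sum_(j < n.+2 | j != i) h (X i - X j)%R +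
    (Num.sqrt n.+2%:R * \sum_(k < n.+2) 2 ^- k *
      (\sum_(i < n.+2) phi k (X i)) ^+ 2)%:E <=
    (n.+2%:R ^+ 2 * I + 2 * Num.sqrt n.+2%:R * n.+2%:R)%:E.
  exact: (exists_quantization n.+2 (measurable_comp_sub mh) (fun=> h0 _) Ih
    mphi phi1 Iphi (sqrtr_ge0 n.+2%:R)).
pose X n := sval (cid (exX n)); have HX n := svalP (cid (exX n)).
have Nq n : (n.+2%:R = Num.sqrt n.+2%:R ^+ 2 :> R)%R by rewrite sqr_sqrtr.
exists X; split; last first.
  (* [sqrt N > 2 / e] turns the excess [2 * sqrt N * N] into at most [e * N ^ 2]. *)
  move=> e e0; have [k _ kn] := near_sqrt_natr_gt (2 / e).
  exists k => // n /kn /=; rewrite ltr_pdivrMr// => qe.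
  apply: (le_trans (le_trans _ (HX n))).
    rewrite leeDl// lee_fin mulr_ge0// sumr_ge0// => i _.
    by rewrite mulr_ge0 ?sqr_ge0// invr_ge0 exprn_ge0.
  rewrite lee_fin; move: qe (sqrtr_ge0 (n.+2%:R : R)) (Nq n).
  move: (Num.sqrt _) => q qe q0 ->.
  have := ler_wpM2r (exprn_ge0 3 q0) (ltW qe); lra.
apply: narrow_cvg_of_tent => s.
rewrite Ec.
have Emu n : \int[empirical (X n)]_x (tent s x)%:E =
    (n.+2%:R^-1 * \sum_(i < n.+2) tent s (X n i))%:E.
  rewrite integral_empirical; last 2 first.
  - exact: tent_measurable.
  - by move=> x; rewrite lee_fin.
  by rewrite sumEFin -EFinM.
under eq_fun do rewrite Emu.
apply: cvg_EFin; first by apply: nearW.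
apply/(@cvgrPdist_lt _ R^o) => e e0.
set k := pickle s.
(* Undoing the normalisation by [1 + B s] turns [b] into [e / 2]. *)
set b := (e / (2 * (1 + B s)))%R.
have b0 : (0 < b)%R by rewrite divr_gt0// mulr_gt0.
have [l _ ln] := near_sqrt_natr_gt (2 ^+ k * (I + 2) / b ^+ 2).
exists (maxn k l) => // n /=; rewrite geq_max => /andP[kn /ln /= {}ln].
(* With [N] points only the first [N] test functions are weighed, so [k] must be among them. *)
have kn2 : (k < n.+2)%N by rewrite (leq_ltn_trans kn)// ltnW.
have SE : (\sum_(i < n.+2) phi k (X n i) =
    (\sum_(i < n.+2) tent s (X n i) - n.+2%:R * c s) / (1 + B s))%R.
  rewrite /phi /k pickleK -mulr_suml; congr (_ * _)%R.
  by rewrite big_split/= sumr_const card_ord mulNrn mulr_natl.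
have {HX} : (Num.sqrt n.+2%:R * (2 ^- k * (\sum_(i < n.+2) phi k (X n i)) ^+ 2) <=
    n.+2%:R ^+ 2 * I + 2 * Num.sqrt n.+2%:R * n.+2%:R :> R)%R.
  rewrite -lee_fin; apply: le_trans (HX n).
  rewrite -[leLHS]add0e; apply: leeD; first by do 2 (apply: sume_ge0 => ? _).
  rewrite lee_fin ler_wpM2l// [leRHS](bigD1 (Ordinal kn2))//= lerDl sumr_ge0// => i _.
  by rewrite mulr_ge0 ?sqr_ge0// invr_ge0 exprn_ge0.
rewrite SE; set A := (\sum_(i < n.+2) _)%R.
have q1 : (1 <= Num.sqrt n.+2%:R :> R)%R.
  by rewrite -[leLHS]sqrtr1 ler_wsqrtr// ler1n.
move: ln; rewrite ltr_pdivrMr ?exprn_gt0//.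
(* With [q = sqrt N] all inequalities become polynomial. *)
move: (Nq n) q1; move: (Num.sqrt n.+2%:R : R)%R => q -> q1 ln hX.
have q0 : (0 < q)%R by exact: lt_le_trans q1.
set y := ((A - q ^+ 2 * c s) / (1 + B s))%R in hX.
have -> : (c s - q ^- 2 * A = - (y * (1 + B s) / q ^+ 2))%R.
  by rewrite /y; field; rewrite !gt_eqF//; exact: B1.
rewrite normrN 2!normrM normfV (gtr0_norm (B1 s)) (gtr0_norm (exprn_gt0 2 q0)).
rewrite ltr_pdivrMr ?exprn_gt0//.
have y2 : (`|y| < q ^+ 2 * b)%R.
  rewrite -(ltr_pXn2r (ltn0Sn 1)) ?nnegrE//; last by rewrite mulr_ge0 ?exprn_ge0// ltW.
  rewrite real_normK ?num_real//.
  have p0 : (0 < 2 ^+ k :> R)%R by rewrite exprn_gt0.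
  rewrite -(ltr_pM2l q0).
  have : (q * y ^+ 2 <= 2 ^+ k * (q ^+ 2 ^+ 2 * I + 2 * q * q ^+ 2))%R.
    by rewrite -ler_pdivrMl// mulrCA.
  (* The threshold on [q] is multiplied by [q ^ 4]; since [q >= 1], the [q ^ 3] term is absorbed
     into [q ^ 4]. *)
  have := ltr_pM2l (exprn_gt0 4 q0) (2 ^+ k * (I + 2))%R (q * b ^+ 2)%R.
  rewrite ln => hln; have : (0 <= 2 ^+ k * 2 * q ^+ 3 * (q - 1))%R.
    by rewrite !mulr_ge0 ?subr_ge0// ?exprn_ge0 ?ltW.
  lra.
have := ltr_pM2r (B1 s) `|y|%R (q ^+ 2 * b)%R; rewrite y2 => yB.
apply: (lt_trans yB).
have bB : (b * (1 + B s) = e / 2)%R by rewrite /b; field; rewrite gt_eqF// B1.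
by have := mulr_gt0 e0 (exprn_gt0 2 q0); rewrite -mulrA bB; lra.
Qed.

Lemma limn_esup_le_energy W rho (b I : R) (X : forall n, 'I_n.+2 -> rV) :
  measurable_fun setT W -> (0 <= b)%R -> (forall x, 0 <= W x + b%:E) ->
  \int[rho]_x \int[rho]_y (W (x - y)%R + b%:E) = I%:E ->
  (forall e : R, (0 < e)%R -> \forall n \near \oo,
    \sum_(i < n.+2) \sum_(j < n.+2 | j != i) (W (X n i - X n j)%R + b%:E) <=
    (n.+2%:R ^+ 2 * (I + e))%:E) ->
  limn_esup (fun n => discrete_energy W (X n)) <= energy W rho.
Proof.
move=> mW b0 W0 EI HX; rewrite (energyD_cst _ mW b0 W0) EI -EFinB -EFinM.
apply/lee_addgt0Pr => e e0; apply: limn_esup_le.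
(* The shift removes [N * (N - 1) * b] instead of [N ^ 2 * b]; once [N > b / e], this costs less
   than [e / 2] after normalisation. *)
have [k _ kn] := HX e e0; have [l _ ln] := near_natr_gt (b / e).
exists (maxn k l) => // n /=; rewrite geq_max => /andP[/kn /= {}kn /ln /= {}ln].
rewrite (discrete_energyD_cst _ b); set H := (X in X - _).
have {}kn : H <= (n.+2%:R ^+ 2 * (I + e))%:E by exact: kn.
have N0 : (0 < n.+2%:R :> R)%R by [].
have : 0 <= H by do 2 (apply: sume_ge0 => ? _).
case: H kn => [H| |]// kn _.
rewrite -EFinB -EFinM -EFinD lee_fin ler_pdivrMl ?mulr_gt0 ?exprn_gt0//.
move: kn ln; rewrite lee_fin ltr_pdivrMr// => kn ln.
have : (n.+1%:R = n.+2%:R - 1 :> R)%R by rewrite -[n.+2%:R]natr1 addrK.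
move=> ->; move: (n.+2%:R : R)%R N0 kn ln => N N0 kn ln.
have := ler_wpM2l (ltW N0) (ltW ln).
have := mulr_gt0 (exprn_gt0 2 N0) e0.
by lra.
Qed.

Lemma gamma_cvg_energy W (A : set (probability rV R)) :
  lower_semicontinuous W -> (exists c : R, forall x, c%:E <= W x) ->
  gamma_cvg (discrete_energy W) (energy W) A.
Proof.
move=> lscW [c cW] rho _.
pose b : R := `|c|%R.
have b0 : (0 <= b)%R by exact: normr_ge0.
have W0 x : 0 <= W x + b%:E.
  apply: (@le_trans _ _ (c%:E + b%:E)); last by rewrite leeD2r.
  by rewrite -EFinD lee_fin -lerBlDr sub0r lerNl ler_normr lexx orbT.
have mW := lsc_measurable lscW.
have mh : measurable_fun setT (fun x => W x + b%:E).
  by apply: emeasurable_funD => //; exact: measurable_cst.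
split=> [X cvX|]; first exact: (energy_le_limn_einf lscW b0 W0 cvX).
have : 0 <= \int[rho]_x \int[rho]_y (W (x - y)%R + b%:E).
  by apply: integral_ge0 => x _; exact: integral_ge0.
case EI : (X in _ <= X) => [I| |]// _.
  have [X [cvX HX]] := exists_recovery mh W0 EI.
  by exists X => //; exact: (limn_esup_le_energy mW b0 W0 EI HX).
(* When the energy is infinite the upper bound is trivial; the zero kernel then supplies a narrowly
   convergent sequence. *)
have I0 : \int[rho]_x \int[rho]_y cst (0 : \bar R) (x - y)%R = 0%:E.
  by under eq_integral do rewrite integral0; rewrite integral0.
have [X [cvX _]] := exists_recovery (measurable_cst _) (fun=> lexx 0) I0.
by exists X => //; rewrite (energyD_cst _ mW b0 W0) EI addye// gt0_muley ?leey//.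
Qed.

End gamma_convergence.

Theorem theorem6p2 (R : realType) (d : nat) (hd : (1 <= d)%N)
    (W : 'rV[R]_d -> \bar R)
    (hWNy : forall x, W x != -oo)
    (hWlsc : lower_semicontinuous W)
    (hWlb : exists c : R, forall x, c%:E <= W x)
    (hWint : locally_integrableE W)
    (hWsym : forall x, W (- x)%R = W x)
    (Winf : \bar R) (hWinfNy : Winf != -oo)
    (hWlim : W x @[x --> enorm_infty] --> Winf)
    (hWincr : exists RW : R, (0 < RW)%R /\ radially_increasing_off RW W) :
  ((exists M : R, forall x, W x <= M%:E) -> upper_semicontinuous W ->
     gamma_cvg (discrete_energy W) (energy W) [set: probability 'rV[R]_d R]) /\
  (forall beta : R, (2 < beta < d%:R)%R ->
     repulsive beta W ->
     C1_off_origin W ->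
     (exists CW : R, [/\ (0 < CW)%R,
        forall x, laplacian0 W x <= CW%:E,
        forall x, (enorm x <= 1)%R ->
          W x <= CW%:E * neg_power (enorm x) (2 - beta)%R &
        forall x, (0 < enorm x <= 1)%R ->
          (enorm (grad (fine \o W) x) <= CW * enorm x `^ (1 - beta))%R]) ->
     gamma_cvg (discrete_energy W) (energy W)
       (morrey_probability (d%:R / (d%:R - beta))%:E)).
Proof.
by split=> [_ _|beta _ _ _ _]; exact: gamma_cvg_energy.
Qed.
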